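(* Let $\mathbb{H}$ be a complex Hilbert space and let $T=\begin{pmatrix}0&A\\ B&0\end{pmatrix}$ on $\mathbb{H}\oplus\mathbb{H}$, where $A,B\in B(\mathbb{H})$. Then, for each choice of sign $\pm$, $$w(T)\geq\frac12\sup_{\theta\in\mathbb{R}}\left\|\mathrm{Re}(e^{i\theta}A)\pm\mathrm{Re}(e^{i\theta}B)\right\|,$$ $$w(T)\geq\frac12\sup_{\theta\in\mathbb{R}}\left\|\mathrm{Im}(e^{i\theta}A)\pm\mathrm{Im}(e^{i\theta}B)\right\|.$$
   Context: $B(\mathbb{H})$ denotes the bounded linear operators on $\mathbb{H}$, and $\|\cdot\|$ on operators is the operator norm. For a bounded operator $S$ on a complex Hilbert space $\mathbb{K}$: $w(S)=\sup\{|\langle Sx,x\rangle| : x\in\mathbb{K}, \|x\|=1\}$ is the numerical radius, $\mathrm{Re}(S)=\frac12(S+S^* )$ and $\mathrm{Im}(S)=\frac1{2i}(S-S^* )$. The direct sum is the Hilbert space direct sum. *)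

(* Defs.v *)
From HB Require Import structures.
From mathcomp Require Import all_boot all_order all_algebra.
From mathcomp Require Import sesquilinear complex.
From mathcomp Require Import all_classical all_reals all_analysis.
From mathcomp Require Import lra.

Set Implicit Arguments.
Unset Strict Implicit.
Unset Printing Implicit Defensive.

Import Order.TTheory GRing.Theory Num.Theory.
Import numFieldNormedType.Exports.

Local Open Scope classical_set_scope.
Local Open Scope ring_scope.
Local Open Scope complex_scope.

(* As in sesquilinear.v, the inner product is linear in its first argument. *)
HB.mixin Record NormedModule_isHilbert (R : realType) H
    & NormedModule R[i] H := {
  hdot : {dot H for (@Num.conj R[i])} ;
  hdot_norm : forall x : H, hdot x x = `|x| ^+ 2
}.

#[short(type="hilbertType")]
HB.structure Definition Hilbert (R : realType) :=
  {H of CompleteNormedModule R[i] H & NormedModule_isHilbert R H}.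


Section dot_norm.
Variables (C : numClosedFieldType) (U : lmodType C) (f : {dot U for Num.conj}).

Lemma dot_cauchy_schwarz (u v : U) : `|f u v| ^+ 2 <= f u u * f v v.
Proof.
have [->|v0] := eqVneq v 0.
  have f0 w : f w 0 = 0 by exact: linear0r.
  by rewrite !f0 normr0 expr0n mulr0.
have fv0 : 0 < f v v by rewrite dnorm_gt0.
pose a := f u v / f v v; pose w := u - a *: v.
have wv : f w v = 0 by rewrite linearBl/= linearZl_LR/= divfK ?subrr// gt_eqF.
have -> : u = w + a *: v by rewrite subrK.
rewrite linearDl/= wv add0r linearZl_LR/= normrM (ger0_norm (dnorm_ge0 _ _)).
have waw : f w (a *: v) = 0 by rewrite linearZr_LR/= wv mulr0.
rewrite exprMn dnormD waw conjC0 !addr0.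
by rewrite dnormZ mulrDl -[X in _ + X]mulrA -expr2 lerDr mulr_ge0.
Qed.

Lemma dot_triangle (u v : U) :
  sqrtC (f (u + v) (u + v)) <= sqrtC (f u u) + sqrtC (f v v).
Proof.
rewrite -ler_sqr ?nnegrE ?addr_ge0 ?sqrtC_ge0// sqrrD !sqrtCK dnormD.
rewrite -addrA addrCA -addrA addrCA lerD2l [leRHS]addrC lerD2l.
have CS : `|f u v| <= sqrtC (f u u) * sqrtC (f v v).
  rewrite -sqrtCM ?nnegrE// -[leLHS]sqrCK// ler_sqrtC ?nnegrE ?mulr_ge0 ?exprn_ge0//.
  exact: dot_cauchy_schwarz.
rewrite -mulr_natl -[_ + _](divfK (negbT (pnatr_eq0 C 2))) mulrC -ReE.
rewrite ler_pM2l ?ltr0n// (le_trans _ CS)//.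
exact: (leif_Re_Creal _).1.
Qed.

Lemma dot_normZ (a : C) (u : U) :
  sqrtC (f (a *: u) (a *: u)) = `|a| * sqrtC (f u u).
Proof. by rewrite dnormZ sqrtCM ?nnegrE ?exprn_ge0// sqrCK. Qed.

Lemma dot_norm0_eq0 (u : U) : sqrtC (f u u) = 0 -> u = 0.
Proof. by move/eqP; rewrite sqrt_dnorm_eq0 => /eqP. Qed.

End dot_norm.

(* An alias of the product, whose own norm in the library is the maximum of the
   norms of the components. *)
Definition hsum (H K : Type) : Type := (H * K)%type.

Section hsum.
Context (R : realType) (H K : hilbertType R).

HB.instance Definition _ := GRing.Lmodule.copy (hsum H K) (H * K)%type.

Definition hsum_dot (x y : hsum H K) : R[i] := hdot x.1 y.1 + hdot x.2 y.2.

Let hsum_dotBl (z : hsum H K) : zmod_morphism (hsum_dot ^~ z).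
Proof. by move=> x y; rewrite /hsum_dot !linearBl opprD addrACA. Qed.

Let hsum_dotBr (z : hsum H K) : zmod_morphism (hsum_dot z).
Proof. by move=> x y; rewrite /hsum_dot !linearBr opprD addrACA. Qed.

Let hsum_dotZl (z : hsum H K) : scalable_for *%R (hsum_dot ^~ z).
Proof. by move=> a x; rewrite /hsum_dot !linearZl_LR mulrDr. Qed.

Let hsum_dotZr (z : hsum H K) :
  scalable_for ((@Num.conj R[i]) \; *%R) (hsum_dot z).
Proof. by move=> a x; rewrite /hsum_dot !linearZr_LR/= mulrDr. Qed.

HB.instance Definition _ := isBilinear.Build _ _ _ _ _ _ hsum_dot
  hsum_dotBl hsum_dotBr hsum_dotZl hsum_dotZr.

Let hsum_dotC (x y : hsum H K) :
  hsum_dot x y = (-1) ^+ false * Num.conj (hsum_dot y x).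
Proof. by rewrite /hsum_dot mul1r rmorphD/= hermC [X in _ + X]hermC !mul1r. Qed.

HB.instance Definition _ := isHermitianSesquilinear.Build _ _ _ _ hsum_dot
  hsum_dotC.

Let hsum_dot_gt0 (x : hsum H K) : x != 0 -> 0 < hsum_dot x x.
Proof.
move=> x0; rewrite lt_neqAle eq_sym addr_ge0// andbT.
by rewrite paddr_eq0// !dnorm_eq0; apply: contra x0.
Qed.

HB.instance Definition _ := isDotProduct.Build _ _ hsum_dot hsum_dot_gt0.

HB.instance Definition _ := Lmodule_isNormed.Build R[i] (hsum H K)
  (dot_triangle hsum_dot) (dot_normZ hsum_dot) (@dot_norm0_eq0 _ _ hsum_dot).

Lemma hsum_normE (x : hsum H K) : `|x| = sqrtC (`|x.1| ^+ 2 + `|x.2| ^+ 2).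
Proof. by rewrite -!hdot_norm. Qed.

Let hsum_dot_norm (x : hsum H K) : hsum_dot x x = `|x| ^+ 2.
Proof. by rewrite hsum_normE sqrtCK -!hdot_norm. Qed.

Let hsum_norm1 (x : hsum H K) : `|x.1| <= `|x|.
Proof.
rewrite -ler_sqr ?nnegrE// hsum_normE sqrtCK.
by rewrite lerDl exprn_ge0.
Qed.

Let hsum_norm2 (x : hsum H K) : `|x.2| <= `|x|.
Proof.
rewrite -ler_sqr ?nnegrE// hsum_normE sqrtCK.
by rewrite lerDr exprn_ge0.
Qed.

Let hsum_norm_le (x : hsum H K) : `|x| <= `|x.1| + `|x.2|.
Proof.
rewrite -ler_sqr ?nnegrE ?addr_ge0// hsum_normE sqrtCK sqrrD.
by rewrite -addrA lerD2l lerDr mulrn_wge0 ?mulr_ge0.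
Qed.

Let hsum_complete (F : set_system (hsum H K)) :
  ProperFilter F -> cauchy F -> cvg F.
Proof.
move=> FF /cauchy_ballP Fc.
have c1 : cvg ((fst : hsum H K -> H) @ F).
  apply: cauchy_cvg; apply/cauchy_ballP => e e0.
  rewrite near_map2; apply: filterS (Fc e e0) => -[x y] /=.
  by rewrite -!ball_normE/=; apply: le_lt_trans; exact: (hsum_norm1 (x - y)).
have c2 : cvg ((snd : hsum H K -> K) @ F).
  apply: cauchy_cvg; apply/cauchy_ballP => e e0.
  rewrite near_map2; apply: filterS (Fc e e0) => -[x y] /=.
  by rewrite -!ball_normE/=; apply: le_lt_trans; exact: (hsum_norm2 (x - y)).
apply/cvg_ex; exists (lim (fst @ F), lim (snd @ F)).
apply/cvgrPdist_lt => e e0; have e20 : 0 < e / 2 by rewrite divr_gt0.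
near=> x; rewrite (le_lt_trans (hsum_norm_le _))//= (splitr e) ltrD//.
  by near: x; move/cvgrPdist_lt : c1; apply.
by near: x; move/cvgrPdist_lt : c2; apply.
Unshelve. all: by end_near. Qed.

HB.instance Definition _ := Uniform_isComplete.Build (hsum H K) hsum_complete.
HB.instance Definition _ := NormedModule_isHilbert.Build R (hsum H K) hsum_dot_norm.
End hsum.

Section riesz.
Context (R : realType) (H : hilbertType R).
Implicit Types x y z : H.

Let q x : R := complex.Re `|x|.

Let qE x : (q x)%:C = `|x|.
Proof. by rewrite RRe_real// ger0_real. Qed.

Let q_ge0 x : 0 <= q x.
Proof. by rewrite -lecR qE normr_ge0. Qed.

Let qD x y : q (x + y) <= q x + q y.
Proof. by rewrite -lecR rmorphD/= !qE ler_normD. Qed.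

Let q_para x y : q (x + y) ^+ 2 + q (x - y) ^+ 2 = 2 * (q x ^+ 2 + q y ^+ 2).
Proof.
apply: (@complexI R); rewrite rmorphM !rmorphD/= !rmorphXn/= !qE -!hdot_norm.
by rewrite rmorph1 dnormD dnormB addrACA subrr addr0 -mulr2n -mulr_natl.
Qed.

Lemma riesz (f : H -> R[i]) (M : R) :
  (forall a x y, f (a *: x + y) = a * f x + f y) ->
  (forall x, `|f x| <= M%:C * `|x|) ->
  exists z, forall x, f x = hdot x z.
Proof.
move=> flin fM.
have f0 : f 0 = 0.
  by have := flin (-1) 0 0; rewrite scaler0 addr0 mulN1r addNr.
have fZ a x : f (a *: x) = a * f x by have := flin a x 0; rewrite f0 !addr0.
have fB x y : f (x - y) = f x - f y.
  by rewrite addrC -scaleN1r flin mulN1r addrC.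
have [fz|/existsNP[u0 /eqP u0P]] := pselect (forall x, f x = 0).
  by exists 0 => x; rewrite fz; apply/esym; exact: linear0r.
pose E := [set x | f x = 1].
have E0 : E ((f u0)^-1 *: u0) by rewrite /E/= fZ mulVf.
pose d := inf (q @` E).
have hi : has_inf (q @` E).
  split; first by exists (q ((f u0)^-1 *: u0)); exists ((f u0)^-1 *: u0).
  by exists 0 => _ [x _ <-]; exact: q_ge0.
have dE x : E x -> d <= q x.
  by move=> Ex; apply: ge_inf; [case: hi|exists x].
have d0 : 0 <= d by apply: lb_le_inf; [case: hi|move=> _ [x _ <-]; exact: q_ge0].
pose B e := E `&` [set x | q x < d + e].
pose F := filter_from [set e : R | 0 < e] B.
have FF : ProperFilter F.
  apply: filter_from_proper.
    apply: filter_from_filter; first by exists 1; exact: ltr01.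
    move=> e e' e0 e0'; exists (Num.min e e'); first by rewrite /= lt_min; apply/andP.
    by move=> x [Ex/=]; rewrite -ltrBlDl lt_min => /andP[? ?]; split; split => //=;
      rewrite -ltrBlDl.
  move=> e e0; have [_ [x Ex <-] xe] := inf_adherent e0 hi.
  by exists x; split.
have diam e x y : 0 < e -> B e x -> B e y -> q (x - y) ^+ 2 <= 4 * e * (2 * d + e).
  move=> e0 [Ex /= xe] [Ey /= ye].
  have xy : 2 * d <= q (x + y).
    have -> : x + y = 2 *: (2^-1 *: x + 2^-1 *: y).
      by rewrite -scalerDr scalerA divff ?scale1r.
    rewrite -lecR qE normrZ normr_nat -qE rmorphM/= rmorph_nat.
    rewrite ler_pM2l ?ltr0n// lecR; apply: dE.
    by rewrite /E/= flin fZ Ex Ey mulr1 [RHS]splitr mul1r.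
  have := q_para x y; have := q_ge0 x; have := q_ge0 y; nra.
have Fc : cauchy F.
  apply: cauchy_exP => eta eta0.
  pose r := complex.Re eta.
  have etaE : eta = r%:C by rewrite RRe_real// gtr0_real.
  have r0 : 0 < r by rewrite -ltcR -etaE.
  have k0 : 0 < 8 * (2 * d + 1) by lra.
  pose e := Num.min 1 (r ^+ 2 / (8 * (2 * d + 1))).
  have e0 : 0 < e by rewrite lt_min ltr01 divr_gt0 ?exprn_gt0.
  have [_ [x Ex <-] xe] := inf_adherent e0 hi.
  exists x, e => // y Bey.
  rewrite -ball_normE/= -qE etaE ltcR -ltr_sqr ?nnegrE ?(ltW r0)//.
  apply: (le_lt_trans (diam _ _ _ e0 _ Bey)); first by split.
  have e1 : e <= 1 by rewrite ge_min lexx.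
  have : e <= r ^+ 2 / (8 * (2 * d + 1)) by rewrite ge_min lexx orbT.
  rewrite ler_pdivlMr// => e2.
  have : 0 < r ^+ 2 by rewrite exprn_gt0.
  nra.
have [l Fl] : exists l : H, F --> l by apply/cvg_ex; exact: cauchy_cvg.
have lP r : 0 < r -> exists x, [/\ E x, q x < d + r & q (l - x) < r].
  move=> r0.
  have F1 : F (ball l r%:C) by apply: Fl; apply: nbhsx_ballx; rewrite ltcR.
  have F2 : F (B r) by exists r.
  have [x [+ [? ?]]] := filter_ex (filterI F1 F2).
  by rewrite -ball_normE/= -qE ltcR => ?; exists x.
have fl : f l = 1.
  apply/eqP; rewrite -subr_eq0 -normr_eq0; apply/eqP.
  pose n := complex.Re `|f l - 1|.
  have nE : `|f l - 1| = n%:C by rewrite RRe_real// ger0_real.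
  rewrite nE; suff -> : n = 0 by [].
  apply/eqP; rewrite eq_le; apply/andP; split; last by rewrite -lecR -nE normr_ge0.
  apply/ler_addgt0Pr => r r0; rewrite add0r.
  have k0 : 0 < r / (`|M| + 1) by rewrite divr_gt0// ltr_wpDl.
  have [x [Ex _ xl]] := lP _ k0.
  have := fM (l - x); rewrite fB Ex nE -qE -rmorphM lecR => /le_trans; apply.
  rewrite ltr_pdivlMr ?ltr_wpDl// in xl.
  have := ler_norm M; have := q_ge0 (l - x); nra.
have ql : q l <= d.
  apply/ler_addgt0Pr => r r0.
  have r20 : 0 < r / 2 by rewrite divr_gt0.
  have [x [Ex xd xl]] := lP _ r20.
  have := qD (l - x) x; rewrite subrK; lra.
have lortho y : f y = 0 -> hdot l y = 0.
  move=> fy; have [->|y0] := eqVneq y 0; first exact: linear0r.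
  have hy : 0 < hdot y y by rewrite dnorm_gt0.
  pose a := hdot l y / hdot y y; pose w := l - a *: y.
  have wy : hdot w y = 0 by rewrite linearBl/= linearZl_LR/= divfK ?subrr// gt_eqF.
  have way : hdot w (a *: y) = 0 by rewrite linearZr_LR/= wy mulr0.
  have Ew : E w by rewrite /E/= /w fB fZ fy mulr0 subr0.
  have : hdot l l <= hdot w w.
    rewrite !hdot_norm -!qE -!rmorphXn lecR ler_sqr ?nnegrE//.
    exact: le_trans ql (dE _ Ew).
  have lw : l = w + a *: y by rewrite subrK.
  rewrite {1 2}lw dnormD way conjC0 !addr0 gerDl dnormZ pmulr_lle0// => a2.
  have : `|a| ^+ 2 == 0 by rewrite eq_le a2 exprn_ge0.
  by rewrite expf_eq0/= normr_eq0 mulf_eq0 invr_eq0 (gt_eqF hy) orbF => /eqP.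
have hl : hdot l l != 0.
  rewrite dnorm_eq0; apply/eqP => l0.
  by move: fl; rewrite l0 f0 => /esym/eqP; rewrite oner_eq0.
exists ((hdot l l)^-1 *: l) => x.
have fy : f (x - f x *: l) = 0 by rewrite fB fZ fl mulr1 subrr.
have xl : hdot x l = f x * hdot l l.
  have := lortho _ fy; rewrite hermC expr0 mul1r => /eqP.
  rewrite conjC_eq0 linearBl/= linearZl_LR/= subr_eq0 => /eqP //.
rewrite linearZr_LR/= xl fmorphV/= (geC0_conj (dnorm_ge0 _ _)).
by rewrite mulrCA mulVf// mulr1.
Qed.

End riesz.

Section operators.
Context (R : realType).
Implicit Types H K : hilbertType R.

Definition bounded_op H K (S : H -> K) : Prop :=
  exists M : R, forall x, `|S x| <= M%:C * `|x|.

(* The suprema below are taken in R; sup set0 = 0, so that the operator norm and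
   the numerical radius are both 0 on the zero space. *)
Definition opnorm H K (S : H -> K) : R :=
  sup [set complex.Re `|S x| | x in [set x : H | `|x| <= 1]].

Definition numradius H (S : H -> H) : R :=
  sup [set complex.Re `|hdot (S x) x| | x in [set x : H | `|x| = 1]].

(* See adjointP: the set below is not empty when S is bounded and linear. *)
Definition adjoint H K (S : H -> K) : K -> H :=
  get [set S' | forall x y, hdot (S x) y = hdot x (S' y)].

Definition opRe H (S : H -> H) : H -> H := 2^-1 *: (S + adjoint S).

Definition opIm H (S : H -> H) : H -> H := (2 * 'i)^-1 *: (S - adjoint S).

(* The block matrix ((A, B), (C, D)). *)
Definition blockop H K (A : H -> H) (B : K -> H) (C : H -> K) (D : K -> K) :
    hsum H K -> hsum H K :=
  fun x => (A x.1 + B x.2, C x.1 + D x.2).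

(* exp (i t) *)
Definition expi (t : R) : R[i] := cos t +i* sin t.

End operators.

Lemma adjointP (R : realType) (H K : hilbertType R) (S : {linear H -> K}) :
  bounded_op S -> forall x y, hdot (S x) y = hdot x (adjoint S y).
Proof.
move=> [M SM].
suff : exists S' : K -> H, forall x y, hdot (S x) y = hdot x (S' y).
  by move=> /(@getPex _ [set S' : K -> H | _]).
suff /choice[S' SS'] : forall y, exists z, forall x, hdot (S x) y = hdot x z.
  by exists S' => x y; exact: SS'.
move=> y; apply: (@riesz _ _ _ (M * complex.Re `|y|)) => [a u v|x].
  by rewrite linearP linearDl/= linearZl_LR.
have yE : (complex.Re `|y|)%:C = `|y| by rewrite RRe_real// ger0_real.
rewrite rmorphM/= yE mulrAC.
apply: (@le_trans _ _ (`|S x| * `|y|)); last by rewrite ler_wpM2r.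
rewrite -ler_sqr ?nnegrE ?mulr_ge0// exprMn -!hdot_norm.
exact: dot_cauchy_schwarz.
Qed.

(* Main.v *)
(* Each operator whose norm is taken is Hermitian, with quadratic form the real
   (resp. imaginary) part of exp(it) <(A +- B) x, x>; its norm is therefore at
   most the numerical radius of A +- B. Testing T on (x, x) and (x, ix), both of
   squared norm 2|x|^2, gives <Ax, x> + <Bx, x> and i (<Ax, x> - <Bx, x>), whence
   w(A +- B) <= 2 w(T). *)
Require Import Defs.
From mathcomp Require Import all_boot all_order all_algebra.
From mathcomp Require Import sesquilinear complex.
From mathcomp Require Import all_classical all_reals all_analysis.
From mathcomp Require Import ring.

Import Order.TTheory GRing.Theory Num.Theory.
Import numFieldNormedType.Exports.

Local Open Scope classical_set_scope.
Local Open Scope ring_scope.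

Section numerical_radius.
Set Implicit Arguments.
Unset Strict Implicit.
Local Open Scope complex_scope.
Context {R : realType}.
Implicit Types H K : hilbertType R.

Lemma RRe_norm (z : R[i]) : (complex.Re `|z|)%:C = `|z|.
Proof. by rewrite RRe_real// ger0_real. Qed.

Lemma RRe_hnorm H (x : H) : (complex.Re `|x|)%:C = `|x|.
Proof. by rewrite RRe_real// ger0_real. Qed.

Lemma hdotC H (x y : H) : hdot x y = Num.conj (hdot y x).
Proof. by rewrite hermC expr0 mul1r. Qed.

Lemma hdot_cauchy_schwarz H (x y : H) : `|hdot x y| <= `|x| * `|y|.
Proof.
rewrite -ler_sqr ?nnegrE ?mulr_ge0// exprMn -!hdot_norm.
exact: dot_cauchy_schwarz.
Qed.

Lemma numradius_ge0 H (T : H -> H) : 0 <= numradius T.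
Proof.
rewrite /numradius; set E := (X in sup X).
(* On an empty or unbounded set [sup] takes the value 0; otherwise the supremum dominates some
   modulus. *)
have [[[r Er] Eu]|/sup_out-> //] := pselect (has_sup E).
apply: le_trans (ub_le_sup Eu Er).
by case: Er => x _ <-; rewrite -lecR RRe_norm normr_ge0.
Qed.

(** Boundedness and Cauchy-Schwarz make the supremum a genuine upper bound on unit vectors;
    homogeneity then brings out the factor [|x| ^+ 2]. Asking only for homogeneity lets this apply
    to [blockop], a plain function. *)
Lemma hdot_le_numradius H (T : H -> H) : bounded_op T ->
    (forall a x, T (a *: x) = a *: T x) ->
  forall x, `|hdot (T x) x| <= (numradius T)%:C * `|x| ^+ 2.
Proof.
move=> [M TM] TZ.
have T1 x : `|x| = 1 -> `|hdot (T x) x| <= (numradius T)%:C.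
  move=> x1; rewrite -RRe_norm lecR; apply: ub_le_sup; last by exists x.
  exists M => _ [y y1 <-]; rewrite -lecR RRe_norm.
  rewrite (le_trans (hdot_cauchy_schwarz _ _))// y1 mulr1.
  by rewrite (le_trans (TM y))// y1 mulr1.
move=> x; have [->|x0] := eqVneq x 0.
  by rewrite linear0r !normr0 expr0n mulr0.
have nx0 : `|x| != 0 by rewrite normr_eq0.
have /T1 : `|(`|x|^-1 *: x)| = 1 by rewrite normrZ normfV normr_id mulVf.
rewrite TZ linearZl_LR linearZr_LR/= mulrA normrM normrM norm_conjC normfV.
rewrite normr_id -invfM -expr2 mulrC.
by rewrite ler_pdivrMr// exprn_gt0// lt_neqAle eq_sym nx0/=.
Qed.

(* A Hermitian form satisfies the polarization identity
   4 Re <Sx, y> = <S(x+y), x+y> - <S(x-y), x-y>; take y = Sx / |Sx|. *)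
Lemma opnorm_symmetric H (S : H -> H) (W : R) : 0 <= W ->
    (forall x y, hdot (S x) y = hdot x (S y)) ->
    (forall x, `|hdot (S x) x| <= W%:C * `|x| ^+ 2) ->
  opnorm S <= W.
Proof.
move=> W0 SS SW; apply: ge_sup.
  by exists (complex.Re `|S 0|), 0; rewrite //= normr0.
move=> _ [x /= x1 <-]; rewrite -lecR RRe_hnorm.
have [->|Sx0] := eqVneq (S x) 0; first by rewrite normr0 lecR.
have nSx0 : `|S x| != 0 by rewrite normr_eq0.
pose y := `|S x|^-1 *: S x.
have y1 : `|y| = 1 by rewrite normrZ normfV normr_id mulVf.
have Sxy : hdot (S x) y = `|S x|.
  rewrite linearZr_LR/= hdot_norm fmorphV/= (geC0_conj (normr_ge0 _)).
  by rewrite expr2 mulKf.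
(* Both cross terms equal the real number [|S x|], so polarization needs no real part. *)
have Syx : hdot (S y) x = `|S x|.
  by rewrite SS hdotC Sxy geC0_conj.
have polar : 4 * `|S x| = hdot (S (x + y)) (x + y) - hdot (S (x - y)) (x - y).
  rewrite !SS [hdot (x + y) _]linearDl [hdot (x - y) _]linearBl/= -!SS.
  rewrite !linearDr !linearNr/= Sxy Syx.
  ring.
have parallelogram : `|x + y| ^+ 2 + `|x - y| ^+ 2 = 2 * (`|x| ^+ 2 + `|y| ^+ 2).
  rewrite -!hdot_norm dnormD dnormB; ring.
(* The two forms add up to at most [2 * W * (|x|^2 + |y|^2)] by the parallelogram identity, with
   [|x| <= 1] and [|y| = 1]. *)
have : 4 * `|S x| <= 4 * W%:C.
  rewrite -[leLHS]ger0_norm ?mulr_ge0// polar (le_trans (ler_normB _ _))//.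
  rewrite (le_trans (lerD (SW _) (SW _)))// -mulrDr parallelogram mulrC.
  have -> : 4 * W%:C = (2 * (1 + 1)) * W%:C by ring.
  rewrite ler_wpM2r ?lecR// ler_wpM2l// y1 expr1n lerD2r.
  by rewrite expr_le1.
by rewrite ler_pM2l.
Qed.

(** Common to the four inequalities, with [D] the sum or difference of [A] and [B]. Exchanging [x]
    and [y] conjugates the form of [S], so [S] is symmetric; on the diagonal it is twice the real
    part of [k * hdot (D x) x], and [2 * |k| <= 1]. *)
Lemma opnorm_hermitian_part H (D S : H -> H) (k : R[i]) (W : R) : 0 <= W ->
    `|k| <= 2^-1 ->
    (forall x y, hdot (S x) y =
      k * hdot (D x) y + Num.conj (k * hdot (D y) x)) ->
    (forall x, `|hdot (D x) x| <= W%:C * `|x| ^+ 2) ->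
  opnorm S <= W.
Proof.
move=> W0 k2 SE DW; apply: opnorm_symmetric => // [x y|x].
  by rewrite [RHS]hdotC !SE rmorphD/= conjCK addrC.
rewrite SE (le_trans (ler_normD _ _))// norm_conjC normrM -mulrDl.
rewrite -[leRHS]mul1r; apply: ler_pM => //.
by rewrite [leRHS](splitr 1) mul1r lerD.
Qed.

(** Since [adjoint] is picked by [get], exhibiting any one adjoint is enough for the picked map to
    satisfy the defining identity. *)
Lemma adjoint_hdot H K (S : H -> K) (S' : K -> H) :
    (forall x y, hdot (S x) y = hdot x (S' y)) ->
  forall x y, hdot (S x) y = hdot x (adjoint S y).
Proof.
by move=> SS'; have /(@getPex _ [set S'' : K -> H | _]) : exists S'' : K -> H,
  forall x y, hdot (S x) y = hdot x (S'' y) by exists S'.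
Qed.

Lemma adjointZ_hdot H (A : {linear H -> H}) (c : R[i]) : bounded_op A ->
  forall x y, hdot ((c *: (A : H -> H)) x) y =
              hdot x (adjoint (c *: (A : H -> H)) y).
Proof.
move=> bA; apply: (@adjoint_hdot _ _ _ (fun y => Num.conj c *: adjoint A y)).
by move=> x y; rewrite linearZl_LR linearZr_LR/= conjCK adjointP.
Qed.

Lemma hdot_opRe H (S : H -> H) :
    (forall x y, hdot (S x) y = hdot x (adjoint S y)) ->
  forall x y, hdot (opRe S x) y =
    2^-1 * hdot (S x) y + Num.conj (2^-1 * hdot (S y) x).
Proof.
move=> SS x y; rewrite linearZl_LR linearDl/= mulrDr rmorphM/= fmorphV/=.
by rewrite rmorph_nat (SS y x) -hdotC.
Qed.

Lemma hdot_opIm H (S : H -> H) :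
    (forall x y, hdot (S x) y = hdot x (adjoint S y)) ->
  forall x y, hdot (opIm S x) y =
    (2 * 'i)^-1 * hdot (S x) y + Num.conj ((2 * 'i)^-1 * hdot (S y) x).
Proof.
move=> SS x y.
(* This constant is purely imaginary: conjugating it absorbs the minus sign in front of the
   adjoint. *)
have : Num.conj (2 * 'i)^-1 = - (2 * 'i)^-1 :> R[i].
  by rewrite fmorphV rmorphM rmorph_nat/= conjCi mulrN invrN.
rewrite /opIm; move: (2 * 'i)^-1 => k kC; rewrite linearZl_LR linearBl/= mulrBr.
by rewrite rmorphM/= kC mulNr (SS y x) -hdotC.
Qed.

Lemma bounded_blockop0 H (A B : H -> H) : bounded_op A -> bounded_op B ->
  bounded_op (blockop 0 A B 0).
Proof.
(* On the zero space [MA] and [MB] may be negative, hence the absolute values; their sum dominates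
   each of them. *)
move=> [MA AM] [MB BM]; exists (`|MA| + `|MB|) => -[x y].
rewrite /blockop/= !add0r !addr0 !hsum_normE/= rmorphD/=.
have MA0 : 0 <= `|MA|%:C :> R[i] by rewrite lecR.
have MB0 : 0 <= `|MB|%:C :> R[i] by rewrite lecR.
have AM' z : `|A z| <= `|MA|%:C * `|z|.
  by rewrite (le_trans (AM z))// ler_wpM2r// lecR ler_norm.
have BM' z : `|B z| <= `|MB|%:C * `|z|.
  by rewrite (le_trans (BM z))// ler_wpM2r// lecR ler_norm.
rewrite -ler_sqr ?nnegrE ?mulr_ge0 ?addr_ge0 ?sqrtC_ge0 ?addr_ge0 ?exprn_ge0//.
rewrite exprMn !sqrtCK mulrDr addrC; apply: lerD.
  rewrite -exprMn ler_sqr ?nnegrE ?mulr_ge0 ?addr_ge0// (le_trans (BM' x))//.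
  by rewrite ler_wpM2r// lerDr.
rewrite -exprMn ler_sqr ?nnegrE ?mulr_ge0 ?addr_ge0// (le_trans (AM' y))//.
by rewrite ler_wpM2r// lerDl.
Qed.

(* Test the form of T on the vectors (x, a x). *)
Lemma blockop0_hdot H (A B : {linear H -> H}) (a : R[i]) :
    bounded_op A -> bounded_op B -> `|a| = 1 ->
  forall x, `|a * hdot (A x) x + Num.conj a * hdot (B x) x| <=
    (2 * numradius (blockop 0 A B 0))%:C * `|x| ^+ 2.
Proof.
move=> bA bB a1 x.
have TZ b u : blockop 0 A B 0 (b *: u) = b *: blockop 0 A B 0 u.
  by rewrite /blockop/= !add0r !addr0 !linearZ.
have := hdot_le_numradius (bounded_blockop0 bA bB) TZ (x, a *: x).
rewrite hsum_normE sqrtCK/= normrZ a1 mul1r.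
rewrite /hdot/= /hsum_dot/= !add0r !addr0.
rewrite linearZ/= linearZl_LR linearZr_LR/= => /le_trans; apply.
by rewrite rmorphM/= rmorph_nat -mulr2n -[_ *+ 2]mulr_natl mulrCA mulrA.
Qed.

Lemma norm_expi (t : R) : `|expi t| = 1.
Proof. by rewrite normc_def/= cos2Dsin2 sqrtr1. Qed.

End numerical_radius.

Theorem theorem4p6 (R : realType) (H : hilbertType R) (A B : {linear H -> H})
    (bA : bounded_op A) (bB : bounded_op B) :
  let T : hsum H H -> hsum H H := blockop 0 A B 0 in
  [/\ 2^-1 * sup (range (fun t : R =>
        opnorm (opRe (expi t *: (A : H -> H)) + opRe (expi t *: (B : H -> H)))))
      <= numradius T,
      2^-1 * sup (range (fun t : R =>
        opnorm (opRe (expi t *: (A : H -> H)) - opRe (expi t *: (B : H -> H)))))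
      <= numradius T,
      2^-1 * sup (range (fun t : R =>
        opnorm (opIm (expi t *: (A : H -> H)) + opIm (expi t *: (B : H -> H)))))
      <= numradius T
    & 2^-1 * sup (range (fun t : R =>
        opnorm (opIm (expi t *: (A : H -> H)) - opIm (expi t *: (B : H -> H)))))
      <= numradius T].
Proof.
move=> T.
have W0 : 0 <= 2 * numradius T by rewrite mulr_ge0 ?numradius_ge0.
have supP (f : R -> R) : (forall t, f t <= 2 * numradius T) ->
    2^-1 * sup (range f) <= numradius T.
  move=> fW; rewrite ler_pdivrMl//; apply: ge_sup; first by exists (f 0), 0.
  by move=> _ [t _ <-].
have DP (x : H) : `|hdot ((A \+ B) x) x| <= (2 * numradius T)%:C%C * `|x| ^+ 2.
  have := blockop0_hdot bA bB (normr1 _) x.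
  by rewrite conjC1 !mul1r /= [hdot (_ + _) x]linearDl.
(* For [a = 'i] the conjugate is [- 'i], so the tested value is the form of [A \- B] times a factor
   of modulus one. *)
have DN (x : H) : `|hdot ((A \- B) x) x| <= (2 * numradius T)%:C%C * `|x| ^+ 2.
  have := blockop0_hdot bA bB (normCi _) x.
  by rewrite conjCi mulNr -mulrBr normrM normCi mul1r /= [hdot (_ - _) x]linearBl.
(* Real and imaginary parts differ only in the constant [k], whose modulus is one half for every
   angle; this makes the bound uniform in [t]. *)
have kRe t : `|2^-1 * expi t| <= 2^-1 :> R[i].
  by rewrite normrM norm_expi mulr1 normfV normr_nat.
have kIm t : `|(2 * 'i)^-1 * expi t| <= 2^-1 :> R[i].
  by rewrite normrM norm_expi mulr1 normfV normrM normr_nat normCi mulr1.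
split; apply: supP => t.
- apply: (opnorm_hermitian_part W0 (kRe t) _ DP) => x y.
  rewrite linearDl/= !hdot_opRe; try exact: adjointZ_hdot.
  rewrite !linearZl_LR !linearDl/= !rmorphM !rmorphD/=; ring.
- apply: (opnorm_hermitian_part W0 (kRe t) _ DN) => x y.
  rewrite linearBl/= !hdot_opRe; try exact: adjointZ_hdot.
  rewrite !linearZl_LR !linearBl/= !rmorphM !rmorphB/=; ring.
- apply: (opnorm_hermitian_part W0 (kIm t) _ DP) => x y.
  rewrite linearDl/= !hdot_opIm; try exact: adjointZ_hdot.
  rewrite !linearZl_LR !linearDl/= !rmorphM !rmorphD/=; ring.
- apply: (opnorm_hermitian_part W0 (kIm t) _ DN) => x y.
  rewrite linearBl/= !hdot_opIm; try exact: adjointZ_hdot.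
  rewrite !linearZl_LR !linearBl/= !rmorphM !rmorphB/=; ring.
Qed.
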